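(* Let $G$ be a group vertex magic graph, and suppose that for some (finite) Abelian group $\Gamma$, $G$ has a $\Gamma$-vertex magic labeling $\ell$ with magic constant $\mu$ such that $\sum_{v\in V(G)}\ell(v)=\mu$. Then $G$ is not a complete graph.
   Context: Graphs are finite, simple and undirected; in this part of the paper all Abelian groups are finite. For an additive Abelian group $\Gamma$ with identity $0$ and a graph $G$, a $\Gamma$-vertex magic labeling is a map $\ell:V(G)\to\Gamma\setminus\{0\}$ for which there is $\mu\in\Gamma$ (the magic constant) with $w(v)=\sum_{u\in N(v)}\ell(u)=\mu$ for every vertex $v$; $G$ is group vertex magic if it is $\Gamma$-vertex magic for every nontrivial Abelian group $\Gamma$. *)

(* Defs.v *)
From HB Require Import structures.
From mathcomp Require Import all_boot all_order all_algebra.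

Set Implicit Arguments.
Unset Strict Implicit.
Unset Printing Implicit Defensive.

Import GRing.Theory.
Local Open Scope ring_scope.

(* A finite simple undirected graph on the vertex set V is given by its
   adjacency relation e, a symmetric irreflexive relation on V. *)
Definition simple_graph (V : finType) (e : rel V) : Prop :=
  symmetric e /\ irreflexive e.

Definition nbhd (V : finType) (e : rel V) (v : V) : {set V} :=
  [set u | e v u].

Definition weight (V : finType) (e : rel V) (Gamma : finZmodType)
    (l : V -> Gamma) (v : V) : Gamma :=
  \sum_(u in nbhd e v) l u.

Definition magic_labeling (V : finType) (e : rel V) (Gamma : finZmodType)
    (l : V -> Gamma) (mu : Gamma) : Prop :=
  (forall v, l v != 0) /\ (forall v, weight e l v = mu).

Definition vertex_magic (Gamma : finZmodType) (V : finType) (e : rel V) : Prop :=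
  exists (l : V -> Gamma) (mu : Gamma), magic_labeling e l mu.

Definition group_vertex_magic (V : finType) (e : rel V) : Prop :=
  forall Gamma : finZmodType, (1 < #|Gamma|)%N -> vertex_magic Gamma e.

Definition complete_graph (V : finType) (e : rel V) : Prop :=
  forall u v : V, u != v -> e u v.

(* Main.v *)
Require Import Defs.
From HB Require Import structures.
From mathcomp Require Import all_boot all_order all_algebra.

Set Implicit Arguments.
Unset Strict Implicit.
Unset Printing Implicit Defensive.

Import GRing.Theory.
Local Open Scope ring_scope.

(** In a complete graph the neighbours of [v] are all the other vertices, so the total label sum is
    [l v] plus the weight [mu] of [v]. If the total is also [mu], cancelling gives [l v = 0], which
    a labeling forbids. *)

Theorem theorem2p1 (V : finType) (e : rel V)
    (hG : simple_graph e) (hV : (0 < #|V|)%N)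
    (hmagic : group_vertex_magic e)
    (hsum : exists (Gamma : finZmodType) (l : V -> Gamma) (mu : Gamma),
        magic_labeling e l mu /\ \sum_(v : V) l v = mu) :
  ~ complete_graph e.
Proof.
have /card_gt0P[v _] := hV.
case: hG hsum => _ irr_e [Gamma [l [mu [[l_neq0 wl] suml]]]] complete_e.
suff: l v = 0 by apply/eqP/l_neq0.
apply: (addIr mu); rewrite add0r -{1}(wl v) -[RHS]suml (bigD1 v) //=.
(* It remains to match the index sets [nbhd e v] and [u != v]: irreflexivity excludes [v] itself,
   completeness supplies every other vertex. *)
congr (_ + _); apply: eq_bigl => u; rewrite inE.
by case: eqVneq => [->|v_neq_u]; rewrite ?irr_e // complete_e // eq_sym.
Qed.
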